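(* Let $d\ge 1$, let $0<\rho\in\mathbb{R}$, and let $\mathcal{K}$ be a finite simplicial complex. If $\mathcal{K}$ admits a $d$-dimensional Čech representation with respect to $\rho$, then $\mathcal{K}$ admits a generic $d$-dimensional Čech representation with respect to $\rho$. Likewise, if $\mathcal{K}$ admits a $d$-dimensional Vietoris–Rips representation with respect to $\rho$, then it admits a generic $d$-dimensional Vietoris–Rips representation with respect to $\rho$.
   Context: For a subset $X\subset\mathbb{R}^d$ and $\rho>0$: the Vietoris–Rips complex $\mathrm{VR}(X,\rho)$ is the abstract simplicial complex on vertex set $X$ whose $k$-simplices are the subsets $\{x_0,\dots,x_k\}\subset X$ with $\|x_i-x_j\|_2\le\rho$ for all $i,j$; the Čech complex $\check{C}(X,\rho)$ is the abstract simplicial complex on $X$ whose $k$-simplices are the subsets $\{x_0,\dots,x_k\}\subset X$ for which there exists $y\in\mathbb{R}^d$ with $\|x_i-y\|_2\le\rho/2$ for all $i$. Two simplicial complexes $\mathcal{K},\mathcal{L}$ with vertex sets $V(\mathcal{K}),V(\mathcal{L})$ are combinatorially equivalent if there is a bijection $\varphi:V(\mathcal{K})\to V(\mathcal{L})$ with $F\in\mathcal{K}$ iff $\varphi(F)\in\mathcal{L}$. A finite set $X\subset\mathbb{R}^d$ is a $d$-dimensional Čech (resp. Vietoris–Rips) representation of $\mathcal{K}$ with respect to $\rho$ if $\mathcal{K}$ is combinatorially equivalent to $\check{C}(X,\rho)$ (resp. $\mathrm{VR}(X,\rho)$). For finite nonempty $X,Y\subset\mathbb{R}^d$, define $\mathrm{dist}(X,Y)=\min_{f:X\to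 Y\text{ bijective}}\max_{x\in X}\|f(x)-x\|_2$ if $|X|=|Y|$, and $\mathrm{dist}(X,Y)=\infty$ otherwise. A Čech representation $X$ of $\mathcal{K}$ with respect to $\rho$ is generic if there is $\delta>0$ such that for every finite $Y\subset\mathbb{R}^d$ with $\mathrm{dist}(X,Y)<\delta$, the complex $\check{C}(Y,\rho)$ is combinatorially equivalent to $\mathcal{K}$; generic Vietoris–Rips representations are defined analogously with $\mathrm{VR}$ in place of $\check{C}$. *)

(* Defs.v *)
From HB Require Import structures.
From mathcomp Require Import all_boot all_order all_algebra finmap.
From mathcomp Require Import all_classical all_reals all_analysis.

Set Implicit Arguments.
Unset Strict Implicit.
Unset Printing Implicit Defensive.

Import Order.TTheory GRing.Theory Num.Theory.
Local Open Scope fset_scope.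
Local Open Scope classical_set_scope.
Local Open Scope ring_scope.

(* The library norm on 'rV[R]_d is the maximum norm, hence this definition. *)
Definition l2norm (R : realType) (d : nat) (x : 'rV[R]_d) : R :=
  Num.sqrt (\sum_(i < d) x 0 i ^+ 2).

(* Abstract simplicial complexes: simplices are nonempty finite sets (the empty
   set is never counted as a simplex), and the vertices are the 0-simplices. *)
Record simplicial_complex (T : choiceType) := SimplicialComplex {
  simplices :> {fset T} -> Prop;
  simplex_neq0 : forall F, simplices F -> F != fset0;
  simplex_sub : forall F G,
    simplices F -> G != fset0 -> (G `<=` F)%fset -> simplices G }.

Definition vertices (T : choiceType) (K : simplicial_complex T) : set T :=
  [set v | K [fset v]].

Definition finite_complex (T : choiceType) (K : simplicial_complex T) : Prop :=
  finite_set (simplices K).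

(* The bijection is between the vertex sets seen as types, and F ranges over
   the finite subsets of the vertex set of K. *)
Definition comb_equiv (T U : choiceType)
    (K : simplicial_complex T) (L : simplicial_complex U) : Prop :=
  exists phi : vertices K -> vertices L, bijective phi /\
    forall F : {fset vertices K},
      K [fset val v | v in F] <-> L [fset val (phi v) | v in F].

Section Complexes.
Variables (R : realType) (d : nat).
Implicit Types (X : set 'rV[R]_d) (rho : R) (F G : {fset 'rV[R]_d}).

Definition vr_simplices X rho : set {fset 'rV[R]_d} :=
  [set F | [/\ F != fset0, [set` F] `<=` X &
    forall x y, x \in F -> y \in F -> l2norm (x - y) <= rho]].

Lemma vr_simplex_neq0 X rho F : vr_simplices X rho F -> F != fset0.
Proof. by case. Qed.

Lemma vr_simplex_sub X rho F G :
  vr_simplices X rho F -> G != fset0 -> (G `<=` F)%fset ->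
  vr_simplices X rho G.
Proof.
move=> [_ FX Frho] G0 /fsubsetP GF; split=> // [x /= xG|x y xG yG].
  by apply: FX; apply: GF.
by apply: Frho; apply: GF.
Qed.

Definition VR X rho : simplicial_complex 'rV[R]_d :=
  SimplicialComplex (@vr_simplex_neq0 X rho) (@vr_simplex_sub X rho).

Definition cech_simplices X rho : set {fset 'rV[R]_d} :=
  [set F | [/\ F != fset0, [set` F] `<=` X &
    exists y, forall x, x \in F -> l2norm (x - y) <= rho / 2]].

Lemma cech_simplex_neq0 X rho F : cech_simplices X rho F -> F != fset0.
Proof. by case. Qed.

Lemma cech_simplex_sub X rho F G :
  cech_simplices X rho F -> G != fset0 -> (G `<=` F)%fset ->
  cech_simplices X rho G.
Proof.
move=> [_ FX [y Fy]] G0 /fsubsetP GF; split=> // [x /= xG|].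
  by apply: FX; apply: GF.
by exists y => x xG; apply/Fy/GF.
Qed.

Definition Cech X rho : simplicial_complex 'rV[R]_d :=
  SimplicialComplex (@cech_simplex_neq0 X rho) (@cech_simplex_sub X rho).

Lemma l2norm_subrr (x : 'rV[R]_d) : l2norm (x - x) = 0.
Proof.
rewrite subrr /l2norm big1 ?sqrtr0// => i _.
by rewrite mxE expr0n.
Qed.

Lemma vertices_VR X rho : 0 < rho -> vertices (VR X rho) = X.
Proof.
move=> rho0; apply/seteqP; split=> [x [_ + _]|x Xx]; first by apply; rewrite /= inE.
split=> [|y|y z]; first by apply/fset0Pn; exists x; rewrite inE.
  by rewrite /= inE => /eqP ->.
by rewrite !inE => /eqP -> /eqP ->; rewrite l2norm_subrr ltW.
Qed.

Lemma vertices_Cech X rho : 0 < rho -> vertices (Cech X rho) = X.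
Proof.
move=> rho0; apply/seteqP; split=> [x [_ + _]|x Xx]; first by apply; rewrite /= inE.
split=> [|y|]; first by apply/fset0Pn; exists x; rewrite inE.
  by rewrite /= inE => /eqP ->.
by exists x => y; rewrite inE => /eqP ->; rewrite l2norm_subrr divr_ge0// ltW.
Qed.

End Complexes.

(* All norms are nonnegative, so 0 is a neutral default for the maximum; in
   particular dist fset0 fset0 = 0. *)
Definition dist (R : realType) (d : nat) (X Y : {fset 'rV[R]_d}) : \bar R :=
  if #|` X| == #|` Y| then
    \big[Order.min/+oo%E]_(f : {ffun X -> Y} | `[< bijective f >])
      (\big[Order.max/0]_(x : X) l2norm (val (f x) - val x))%:E
  else +oo%E.

Section Representations.
Variables (R : realType) (d : nat) (T : choiceType).
Implicit Types (K : simplicial_complex T) (rho : R) (X : {fset 'rV[R]_d}).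

Definition cech_representation K rho X : Prop :=
  comb_equiv K (Cech [set` X] rho).

Definition vr_representation K rho X : Prop :=
  comb_equiv K (VR [set` X] rho).

Definition generic_cech_representation K rho X : Prop :=
  cech_representation K rho X /\
  exists2 delta : R, 0 < delta & forall Y : {fset 'rV[R]_d},
    (dist X Y < delta%:E)%E -> comb_equiv (Cech [set` Y] rho) K.

Definition generic_vr_representation K rho X : Prop :=
  vr_representation K rho X /\
  exists2 delta : R, 0 < delta & forall Y : {fset 'rV[R]_d},
    (dist X Y < delta%:E)%E -> comb_equiv (VR [set` Y] rho) K.

End Representations.

(* Main.v *)
(* Contracting a representation slightly makes it generic. After contraction all
   simplices are realised strictly below the scale [rho]; and since a finite set
   that spans no simplex at scale [rho] spans none at a slightly larger scale
   either, a small enough contraction creates no new simplex, with a margin that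
   also absorbs small perturbations. The gap above [rho] is obvious for
   Vietoris-Rips complexes and follows from compactness for Cech complexes. *)
Require Import Defs.
From mathcomp Require Import all_boot all_order all_algebra finmap.
From mathcomp Require Import all_classical all_reals all_analysis.
From mathcomp Require Import ring lra.

Local Open Scope ring_scope.

Set Implicit Arguments.
Unset Strict Implicit.
Unset Printing Implicit Defensive.

Import Order.TTheory GRing.Theory Num.Theory.
Import numFieldNormedType.Exports.

(** * Euclidean norm: triangle inequality and continuity *)

Section EuclideanNorm.
Context {R : realType} {d : nat}.
Implicit Types (x y : 'rV[R]_d).

Lemma l2norm_ge0 x : 0 <= l2norm x.
Proof. exact: sqrtr_ge0. Qed.

Lemma sqr_l2norm x : l2norm x ^+ 2 = \sum_(i < d) x 0 i ^+ 2.
Proof. by rewrite sqr_sqrtr// sumr_ge0// => i _; exact: sqr_ge0. Qed.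

Lemma l2normZ (a : R) x : l2norm (a *: x) = `|a| * l2norm x.
Proof.
rewrite -sqrtr_sqr -sqrtrM ?sqr_ge0// mulr_sumr; congr Num.sqrt.
by apply: eq_bigr => i _; rewrite mxE exprMn.
Qed.

Lemma l2normN x : l2norm (- x) = l2norm x.
Proof. by rewrite -scaleN1r l2normZ normrN1 mul1r. Qed.

Lemma normr_coord_le x i : `|x 0 i| <= l2norm x.
Proof.
rewrite -sqrtr_sqr ler_wsqrtr// (bigD1 i)//= lerDl.
by apply: sumr_ge0 => j _; exact: sqr_ge0.
Qed.

(** Expanding the sum of the squares of [b * x 0 i - a * y 0 i] gives [0 <= 2ab(ab - p)], which is
    divided by [ab] once the case of a zero norm is settled. *)
Lemma l2norm_cauchy_schwarz x y :
  \sum_(i < d) x 0 i * y 0 i <= l2norm x * l2norm y.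
Proof.
set p := \sum_(i < d) _; set a := l2norm x; set b := l2norm y.
have [ab0|ab0] := eqVneq (a * b) 0.
  rewrite ab0 /p big1// => i _.
  have := normr_coord_le x i; have := normr_coord_le y i.
  rewrite -/a -/b; case/eqP: ab0; rewrite mulf_eq0 => /orP[]/eqP->.
    by rewrite !normr_le0 => _ /eqP->; rewrite mul0r.
  by rewrite !normr_le0 => /eqP-> _; rewrite mulr0.
have ab_gt0 : 0 < a * b by rewrite lt_def ab0 mulr_ge0// l2norm_ge0.
have : 0 <= \sum_(i < d) (b * x 0 i - a * y 0 i) ^+ 2.
  by apply: sumr_ge0 => i _; exact: sqr_ge0.
under eq_bigr => i _.
  have -> : (b * x 0 i - a * y 0 i) ^+ 2 = b ^+ 2 * x 0 i ^+ 2
    + a ^+ 2 * y 0 i ^+ 2 + (- (2 * (a * b))) * (x 0 i * y 0 i) by ring.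
  over.
rewrite !big_split/= -!mulr_sumr -!sqr_l2norm -/a -/b -/p => h.
rewrite -(ler_pM2l ab_gt0); nra.
Qed.

Lemma l2normD x y : l2norm (x + y) <= l2norm x + l2norm y.
Proof.
rewrite -(@ler_pXn2r _ 2)// ?nnegrE ?addr_ge0 ?l2norm_ge0// sqr_l2norm.
under eq_bigr do rewrite mxE sqrrD.
rewrite !big_split/= -!sqr_l2norm sqrrD lerD2r lerD2l.
by rewrite mulr2n lerD// l2norm_cauchy_schwarz.
Qed.

(** Continuity refers to the library topology on row vectors, hence the coordinatewise argument. *)
Lemma l2norm_dist_continuous x : continuous (fun y => l2norm (x - y)).
Proof.
have -> : (fun y => l2norm (x - y)) =
    (fun y : 'rV[R]_d => Num.sqrt (\sum_(i < d) (x 0 i - y 0 i) ^+ 2)).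
  by apply/funext => y; congr Num.sqrt; apply: eq_bigr => i _; rewrite !mxE.
move=> y; apply: (@continuous_comp _ _ _ _ (@Num.sqrt R)); last first.
  exact: sqrt_continuous.
apply: (@continuous_big _ _ _ _ _ _ _ _
  (fun i (y : 'rV[R]_d) => (x 0 i - y 0 i) ^+ 2)); first exact: add_continuous.
move=> i _ {}y; apply: (@continuous_comp _ _ _ (fun y : 'rV[R]_d => y 0 i)
  (fun t : R => (x 0 i - t) ^+ 2)); first exact: coord_continuous.
apply: (@continuous_comp _ _ _ (fun t : R => x 0 i - t) (fun t : R => t ^+ 2)).
  by apply: cvgB; [exact: cvg_cst|exact: cvg_id].
exact: exprn_continuous.
Qed.

End EuclideanNorm.

(** * Combinatorial equivalences *)

Section CombEquiv.
Local Open Scope fset_scope.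
Local Open Scope classical_set_scope.

Lemma imfset_val_phi (T U : choiceType) (A : set T) (B : set U) (g : T -> U)
    (phi : A -> B) (F : {fset A}) :
  (forall v, val (phi v) = g (val v)) ->
  [fset val (phi v) | v in F] = (g @` [fset val v | v in F])%fset.
Proof.
move=> phiE; apply/fsetP => u; apply/imfsetP/imfsetP => /=.
  move=> [v vF ->]; exists (val v); last exact: phiE.
  by apply/imfsetP; exists v.
by move=> [_ /imfsetP[v vF ->] ->]; exists v => //; rewrite -phiE.
Qed.

(** Restricting [g] to the vertex subtypes gives the required bijection, so that later arguments can
    use maps of the ambient types. *)
Lemma comb_equiv_map (T U : choiceType) (K : simplicial_complex T)
    (L : simplicial_complex U) (g : T -> U) :
  set_bij (vertices K) (vertices L) g ->
  (forall F : {fset T}, [set` F] `<=` vertices K -> K F <-> L (g @` F)%fset) ->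
  comb_equiv K L.
Proof.
move=> [gfun ginj gsurj] gKL.
have gL (v : vertices K) : g (val v) \in vertices L.
  by apply/mem_set/gfun/set_mem/valP.
pose phi (v : vertices K) : vertices L := SigSub (gL v).
exists phi; split=> [|F].
  rewrite -setTT_bijective; split=> // [v w _ _ /(congr1 val)/=|w _].
    by move=> /ginj e; apply/val_inj/e; exact: valP.
  have [v Kv gv] := gsurj _ (set_mem (valP w)).
  by exists (SigSub (mem_set Kv)) => //; apply: val_inj.
rewrite (@imfset_val_phi _ _ _ _ g)//; apply: gKL => v /= /imfsetP[w _ ->].
exact/set_mem/valP.
Qed.

Lemma comb_equiv_trans (T U V : choiceType) (K : simplicial_complex T)
    (L : simplicial_complex U) (M : simplicial_complex V) :
  comb_equiv K L -> comb_equiv L M -> comb_equiv K M.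
Proof.
move=> [phi [phi_bij KL]] [psi [psi_bij LM]].
exists (psi \o phi); split=> [|F]; first exact: bij_comp.
by rewrite KL (imfset_comp _ phi \val) LM -(imfset_comp _ phi).
Qed.

Lemma comb_equiv_sym (T U : choiceType) (K : simplicial_complex T)
    (L : simplicial_complex U) : comb_equiv K L -> comb_equiv L K.
Proof.
move=> [phi [[psi phiK psiK] KL]].
exists psi; split=> [|F]; first by exists phi.
rewrite (imfset_comp _ psi \val) KL -(imfset_comp _ psi).
suff e : [fset \val (phi (psi v)) | v in F] = [fset \val v | v in F].
  by rewrite -e.
by apply/fsetP => u; apply/imfsetP/imfsetP => -[v vF ->]; exists v;
  rewrite //= psiK.
Qed.

End CombEquiv.

(** If every bijection moved some point by more than [delta], all terms of the minimum, and its
    default [+oo], would be at least [delta]. *)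
Lemma dist_lt_bij (R : realType) (d : nat) (X Y : {fset 'rV[R]_d}) (delta : R) :
  (dist X Y < delta%:E)%E ->
  exists2 f : {ffun X -> Y}, bijective f &
    forall x, l2norm (val (f x) - val x) <= delta.
Proof.
rewrite /dist; case: ifP => // _ XYd; apply: contrapT => nf.
move: XYd; rewrite ltNge => /negP; apply; apply/bigmin_geP; split=> [|f].
  exact: leey.
move=> /asboolP fbij; rewrite lee_fin leNgt; apply/negP => fd; apply: nf.
by exists f => // x; apply: (le_trans _ (ltW fd)); exact: le_bigmax.
Qed.

(** * Perturbation and gap properties of the two scale conditions *)

Section ScaleConditions.
Context {R : realType} {d : nat}.
Local Notation V := 'rV[R]_d.
Implicit Types (F : {fset V}) (g h : V -> V) (r s : R).

(* [C F g r] says that the family of points [g x], for [x] in [F], spans a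
   simplex at scale [r]. *)
Record stable_condition (C : {fset V} -> (V -> V) -> R -> Prop) : Prop := {
  stable_perturb : forall F g h (c delta r : R), 0 <= c ->
    (forall x, x \in F -> l2norm (h x - c *: g x) <= delta) ->
    C F g r -> C F h (c * r + delta *+ 2);
  stable_gap : forall F g r, ~ C F g r ->
    exists2 eta, 0 < eta & ~ C F g (r + eta) }.

Definition vr_condition F g r : Prop :=
  forall x y, x \in F -> y \in F -> l2norm (g x - g y) <= r.

Definition cech_condition F g r : Prop :=
  exists y, forall x, x \in F -> l2norm (g x - y) <= r / 2.

(** Each endpoint of a pair contributes one error [delta]. For the gap a single violating pair
    suffices: half its excess over [r] serves as [eta]. *)
Lemma vr_condition_stable : stable_condition vr_condition.
Proof.
split=> [F g h c delta r c0 gh Fr x y xF yF|F g r nFr].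
  have -> : h x - h y =
      (h x - c *: g x) + (c *: (g x - g y) - (h y - c *: g y)).
    by rewrite scalerBr; apply/rowP => i; rewrite !mxE; ring.
  rewrite (le_trans (l2normD _ _))//.
  rewrite [leRHS](_ : _ = delta + (c * r + delta)); last by ring.
  rewrite lerD ?gh// (le_trans (l2normD _ _))// l2normN lerD ?gh//.
  by rewrite l2normZ ger0_norm// ler_wpM2l// Fr.
apply: contrapT => h; apply: nFr => x y xF yF; rewrite leNgt; apply/negP => lt.
apply: h; exists ((l2norm (g x - g y) - r) / 2) => [|/(_ x y xF yF)]; lra.
Qed.

(* The centres [y] compatible with a scale close to [r] lie in a fixed compact
   box, and each of them violates the condition by a locally uniform amount. *)
Lemma cech_condition_gap F g r : ~ cech_condition F g r ->
  exists2 eta, 0 < eta & ~ cech_condition F g (r + eta).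
Proof.
move=> nFr.
have viol y : exists2 x, x \in F & r / 2 < l2norm (g x - y).
  apply: contrapT => h; apply: nFr; exists y => x xF.
  by rewrite leNgt; apply/negP => lt; apply: h; exists x.
have [x0 x0F _] := viol 0.
(* For scales up to [r + 1], every admissible centre is within [m] of [g x0], hence in the box. *)
pose m := (r + 1) / 2.
pose box := [set y : V |
  forall i, `[g x0 0 i - m, g x0 0 i + m]%classic (y 0 i)]%classic.
have box_compact : compact box.
  apply: (@rV_compact R d (fun i => `[g x0 0 i - m, g x0 0 i + m]%classic)) => i.
  exact: segment_compact.
(* Compactness turns the local bounds on [eta] into one threshold valid on the whole box. *)
have /compact_near_coveringP/(_ R (0 : R)^'+%classic (fun eta y =>
  exists2 x, x \in F & (r + eta) / 2 < l2norm (g x - y)) _) := box_compact.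
case=> [y _|e /= e0 he].
  have [x xF lt] := viol y.
  (* Half the excess at [y]: by continuity nearby [z] keep an excess above [e], while a scale
     increase [t < e] raises the radius by only [t / 2]. *)
  pose e := (l2norm (g x - y) - r / 2) / 2.
  have e0 : 0 < e by rewrite /e; lra.
  have cont := @l2norm_dist_continuous R d (g x) y.
  have lt' : r / 2 + e < l2norm (g x - y) by rewrite /e; lra.
  exists ([set z | r / 2 + e < l2norm (g x - z)], [set t | t < e])%classic => /=.
    by split; [exact: (cvgr_gt _ cont)|exact: nbhs_right_lt].
  move=> [z t] /= [zlt tlt]; exists x => //; lra.
(* The bound [e / 2] keeps [eta] below the threshold; the bound [1] keeps the centres in the box. *)
pose eta := Num.min (e / 2) 1.
have eta0 : 0 < eta by rewrite lt_min ltr01 andbT; lra.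
exists eta => // -[y yF].
have eta_near : `|0 - eta| < e.
  by rewrite sub0r normrN gtr0_norm// gt_min; apply/orP; left; lra.
have box_y : box y.
  move=> i /=; rewrite in_itv/= -ler_distl distrC.
  have := normr_coord_le (g x0 - y) i; rewrite !mxE => /le_trans; apply.
  by rewrite (le_trans (yF _ x0F))// /m ler_pM2r// lerD2l ge_min lexx orbT.
have [x xF] := he eta eta_near eta0 y box_y.
by rewrite ltNge yF.
Qed.

(** The scaled centre [c *: y] serves the perturbed points; an error [delta] in the radius costs
    [delta *+ 2] in the scale. *)
Lemma cech_condition_stable : stable_condition cech_condition.
Proof.
split=> [F g h c delta r c0 gh [y Fy]|]; last exact: cech_condition_gap.
exists (c *: y) => x xF.
have -> : h x - c *: y = (h x - c *: g x) + c *: (g x - y).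
  by rewrite scalerBr; apply/rowP => i; rewrite !mxE; ring.
rewrite (le_trans (l2normD _ _))//.
rewrite [leRHS](_ : _ = delta + c * (r / 2)); last by field.
by rewrite lerD ?gh// l2normZ ger0_norm// ler_wpM2l// Fy.
Qed.

(** * Uniform gaps and contraction *)

Variable C : {fset V} -> (V -> V) -> R -> Prop.
Hypothesis C_stable : stable_condition C.

Lemma stable_mono F g r s : r <= s -> C F g r -> C F g s.
Proof.
move=> rs Fr; have -> : s = 1 * r + ((s - r) / 2) *+ 2 by field.
apply: (stable_perturb C_stable) Fr => // x _.
by rewrite scale1r l2norm_subrr; lra.
Qed.

(** Minimum of finitely many gaps, by monotonicity in the scale; sets already satisfying the
    condition allow any positive value. *)
Lemma stable_uniform_gap (s : seq {fset V}) g r : exists2 eta, 0 < eta &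
  forall F, F \in s -> C F g (r + eta) -> C F g r.
Proof.
elim: s => [|F s [eta eta0 IH]]; first by exists 1.
have [e e0 Fe] : exists2 e, 0 < e & C F g (r + e) -> C F g r.
  have [Fr|/(stable_gap C_stable)[e e0 Fe]] := pselect (C F g r).
    by exists 1.
  by exists e.
exists (Num.min e eta) => [|G]; first by rewrite lt_min e0.
rewrite inE => /predU1P[->|Gs] h.
  by apply: Fe; apply: stable_mono h; rewrite lerD2l ge_min lexx.
by apply: IH => //; apply: stable_mono h; rewrite lerD2l ge_min lexx orbT.
Qed.

(* Contracting by the factor [1 - t] moves every simplex strictly below scale
   [rho], while the gap keeps non-simplices strictly above it. *)
Lemma stable_contraction (X : {fset V}) (rho : R) : 0 < rho ->
  exists2 c, 0 < c & exists2 delta, 0 < delta & forall h,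
    (forall x, x \in X -> l2norm (h x - c *: x) <= delta) ->
    forall F, (F `<=` X)%fset -> C F id rho <-> C F h rho.
Proof.
move=> rho0.
have [eta eta0 gap] := stable_uniform_gap (fpowerset X) id rho.
(* Solves [rho * (1 + t) / (1 - t) = rho + eta], the scale reached when the contraction is undone
   below. *)
pose t := eta / (2 * rho + eta).
have D0 : 0 < 2 * rho + eta by lra.
have t0 : 0 < t by exact: divr_gt0.
have tE : t * (2 * rho + eta) = eta by rewrite /t divfK// gt_eqF.
have c0 : 0 < 1 - t by nra.
(* With this error the contracted simplices return exactly to scale [rho]. *)
exists (1 - t) => //; exists (rho * t / 2) => [|h hX F FX].
  by rewrite divr_gt0// mulr_gt0.
have hF x : x \in F -> l2norm (h x - (1 - t) *: x) <= rho * t / 2.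
  by move=> /(fsubsetP FX); exact: hX.
split=> [Frho|].
  have -> : rho = (1 - t) * rho + (rho * t / 2) *+ 2 by field.
  by apply: (stable_perturb C_stable (g := id)) Frho => //; rewrite ltW.
(* Conversely, the identity is a perturbation of [h] rescaled by [(1 - t)^-1]; this yields scale
   [rho + eta], and the gap brings it down to [rho]. *)
move=> Frho; apply: gap; first by rewrite fpowersetE.
pose delta := (1 - t)^-1 * (rho * t / 2).
apply: (@stable_mono _ _ ((1 - t)^-1 * rho + delta *+ 2)).
  rewrite /delta -mulrnAr -mulrDr ler_pdivrMl//.
  nra.
apply: (stable_perturb C_stable) Frho => [|x xF]; first by rewrite invr_ge0 ltW.
have -> : id x - (1 - t)^-1 *: h x = - ((1 - t)^-1 *: (h x - (1 - t) *: x)).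
  by rewrite scalerBr scalerA mulVf ?gt_eqF// scale1r opprB.
by rewrite l2normN l2normZ gtr0_norm ?invr_gt0// ler_pM2l ?invr_gt0// hF.
Qed.

(** * Generic representations from contraction *)

Variables (rho : R) (Cx : set V -> simplicial_complex V).
Hypothesis rho0 : 0 < rho.
Hypothesis vertices_Cx : forall X, vertices (Cx X) = X.
Hypothesis Cx_image : forall (X : set V) F g,
  Cx X (g @` F)%fset <->
  [/\ F != fset0, ([set` (g @` F)%fset] `<=` X)%classic & C F g rho].

(** Take [X'] to be [X] scaled by [c]. Both [X'] and any nearby [Y] are images of [X] under maps
    [delta]-close to the scaling, so each is compared directly with [X]. *)
Lemma stable_generic (X : {fset V}) : exists2 X' : {fset V},
  comb_equiv (Cx [set` X]) (Cx [set` X']) &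
  exists2 delta, 0 < delta & forall Y : {fset V},
    (dist X' Y < delta%:E)%E -> comb_equiv (Cx [set` X]) (Cx [set` Y]).
Proof.
have [c c0 [delta delta0 hX]] := stable_contraction X rho0.
have equiv (h : V -> V) (Y : {fset V}) :
    (forall x, x \in X -> l2norm (h x - c *: x) <= delta) ->
    set_bij [set` X] [set` Y] h -> comb_equiv (Cx [set` X]) (Cx [set` Y]).
  move=> hd hbij; apply: (@comb_equiv_map _ _ _ _ h).
    by rewrite !vertices_Cx.
  move=> F; rewrite vertices_Cx => FX.
  have := Cx_image [set` X] F id; rewrite imfset_id => ->; rewrite Cx_image.
  have FX' : (F `<=` X)%fset by apply/fsubsetP => x /FX.
  have [hfun _ _] := hbij.
  split=> -[F0 FY CF]; split=> //; try exact/(hX h).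
  by move=> y /= /imfsetP[x xF ->]; apply: hfun; exact: FX.
have scale_inj : injective (fun x : V => c *: x).
  by apply: scalerI; rewrite gt_eqF.
pose X' := ((fun x : V => c *: x) @` X)%fset.
have X'P x : x \in X -> c *: x \in X'.
  by move=> xX; apply/imfsetP; exists x.
exists X'.
  apply: (equiv (fun x => c *: x)) => [x _|].
    by rewrite l2norm_subrr ltW.
  split=> [x /= /X'P//|x y _ _ /scale_inj//|y /= /imfsetP[x /= xX ->]].
  by exists x.
exists delta => // Y /dist_lt_bij[f [f' fK f'K] fd].
(* Scaling followed by the matching [f]; the default [0] is never reached on [X], since [c *: x]
   then lies in [X']. *)
pose h (x : V) := if insub (c *: x) is Some u then val (f u) else 0.
have hE x (xX : x \in X) : h x = val (f [` X'P x xX]%fset).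
  by rewrite /h insubT ?X'P//= => p; congr (val (f _)); exact: val_inj.
apply: (equiv h) => [x xX|]; first by rewrite hE; exact: fd.
split=> [x /= xX|x y /set_mem/= xX /set_mem/= yX|y /= yY].
- by rewrite hE; exact: valP.
- rewrite !hE => /val_inj/(can_inj fK)/(congr1 val)/=; exact: scale_inj.
- have /imfsetP[x /= xX xE] := valP (f' [` yY]%fset).
  exists x => //; rewrite hE.
  have -> : [` X'P x xX]%fset = f' [` yY]%fset by apply: val_inj.
  by rewrite f'K.
Qed.

End ScaleConditions.

(** * The Vietoris-Rips and Čech instances *)

Lemma vr_image (R : realType) (d : nat) (rho : R) (X : set 'rV[R]_d)
    (F : {fset 'rV[R]_d}) (g : 'rV[R]_d -> 'rV[R]_d) :
  VR X rho (g @` F)%fset <->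
  [/\ F != fset0, ([set` (g @` F)%fset] `<=` X)%classic &
    vr_condition F g rho].
Proof.
split=> -[F0 FX Fr]; split=> //.
- by apply: contra_neq F0 => ->; rewrite imfset0.
- by move=> x y xF yF; apply: Fr; exact: in_imfset.
- by have [x xF] := fset0Pn _ F0; apply/fset0Pn; exists (g x); exact: in_imfset.
- by move=> _ _ /imfsetP[x /= xF ->] /imfsetP[y /= yF ->]; exact: Fr.
Qed.

Lemma cech_image (R : realType) (d : nat) (rho : R) (X : set 'rV[R]_d)
    (F : {fset 'rV[R]_d}) (g : 'rV[R]_d -> 'rV[R]_d) :
  Cech X rho (g @` F)%fset <->
  [/\ F != fset0, ([set` (g @` F)%fset] `<=` X)%classic &
    cech_condition F g rho].
Proof.
split=> -[F0 FX [y Fy]]; split=> //.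
- by apply: contra_neq F0 => ->; rewrite imfset0.
- by exists y => x xF; apply: Fy; exact: in_imfset.
- by have [x xF] := fset0Pn _ F0; apply/fset0Pn; exists (g x); exact: in_imfset.
- by exists y => _ /imfsetP[x /= xF ->]; exact: Fy.
Qed.

Theorem theorem2p9 (R : realType) (d : nat) (rho : R) (T : choiceType)
    (K : simplicial_complex T) (hd : (1 <= d)%N) (hrho : 0 < rho)
    (hK : finite_complex K) :
  ((exists X : {fset 'rV[R]_d}, cech_representation K rho X) ->
   exists X : {fset 'rV[R]_d}, generic_cech_representation K rho X) /\
  ((exists X : {fset 'rV[R]_d}, vr_representation K rho X) ->
   exists X : {fset 'rV[R]_d}, generic_vr_representation K rho X).
Proof.
split=> -[X KX].
  have [X' XX' [delta delta0 gen]] := stable_generic cech_condition_stable hrho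
    (fun X => vertices_Cech X hrho) (cech_image rho) X.
  exists X'; split; first exact: comb_equiv_trans XX'.
  exists delta => // Y /gen XY.
  exact/comb_equiv_sym/(comb_equiv_trans KX).
have [X' XX' [delta delta0 gen]] := stable_generic vr_condition_stable hrho
  (fun X => vertices_VR X hrho) (vr_image rho) X.
exists X'; split; first exact: comb_equiv_trans XX'.
exists delta => // Y /gen XY.
exact/comb_equiv_sym/(comb_equiv_trans KX).
Qed.
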